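(* Let $X \in \mathbb{R}^{n\times p}$, $\lambda > 0$ and let $\mathrm{pen}:\mathbb{R}^p\to\mathbb{R}$ be a polyhedral gauge. Let $\beta\in\mathbb{R}^p$ have an accessible pattern (with respect to $X$ and $\mathrm{pen}$) and assume that uniform uniqueness holds, i.e. for every $y\in\mathbb{R}^n$ the set $S_{X,\lambda\mathrm{pen}}(y)$ consists of a unique minimizer $\hat\beta(y)$. If $y$ is a random vector whose distribution has a positive Lebesgue density on $\mathbb{R}^n$, then $\mathbb{P}(\hat\beta(y) \overset{\mathrm{pen}}{\sim} \beta) > 0$.
   Context: A prime denotes transpose. A (real-valued) polyhedral gauge on $\mathbb{R}^p$ is a function of the form $\mathrm{pen}(b) = \max\{u_1'b,\dots,u_k'b\}$ for some $u_1,\dots,u_k \in \mathbb{R}^p$ with $u_1 = 0$; $\partial_{\mathrm{pen}}(\beta)$ is its subdifferential at $\beta$. For $y\in\mathbb{R}^n$ and $\lambda>0$ let $S_{X,\lambda\mathrm{pen}}(y) = \mathrm{Arg}\min_{b\in\mathbb{R}^p} \frac12\|y-Xb\|_2^2 + \lambda\,\mathrm{pen}(b)$. Write $b \overset{\mathrm{pen}}{\sim} \beta$ if $\partial_{\mathrm{pen}}(b) = \partial_{\mathrm{pen}}(\beta)$. The pattern of $\beta$ is accessible with respect to $X$ and $\lambda\,\mathrm{pen}$ if there exist $y\in\mathbb{R}^n$ and $\hat\beta \in S_{X,\lambda\mathrm{pen}}(y)$ with $\hat\beta \overset{\mathrm{pen}}{\sim}\beta$; this does not depend on the value of $\lambda>0$,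 so one says ''accessible with respect to $X$ and $\mathrm{pen}$''. *)

(* Defs.v *)
From HB Require Import structures.
From mathcomp Require Import all_boot all_order all_algebra.
From mathcomp Require Import all_classical all_reals all_analysis.

Set Implicit Arguments.
Unset Strict Implicit.
Unset Printing Implicit Defensive.

Import Order.TTheory GRing.Theory Num.Theory.
Import numFieldNormedType.Exports.

Local Open Scope classical_set_scope.
Local Open Scope ring_scope.

Section euclidean.
Context {R : realType}.

Definition dot m (u v : 'cV[R]_m) : R := (u^T *m v) 0 0.

(* The library norm on matrices is the sup norm, hence this definition. *)
Definition norm2 m (v : 'cV[R]_m) : R := Num.sqrt (\sum_i v i 0 ^+ 2).

(* The default value of the big maximum is its first term, here 0. *)
Definition polyhedral_gauge p (pen : 'cV[R]_p -> R) : Prop :=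
  exists (k : nat) (u : 'I_k.+1 -> 'cV[R]_p),
    u ord0 = 0 /\
    forall b, pen b = \big[Num.max/dot (u ord0) b]_(i < k.+1) dot (u i) b.

Definition subdifferential p (pen : 'cV[R]_p -> R) (b : 'cV[R]_p) :
    set 'cV[R]_p :=
  [set s | forall z, pen b + dot s (z - b) <= pen z].

Definition same_pattern p (pen : 'cV[R]_p -> R) (b beta : 'cV[R]_p) : Prop :=
  subdifferential pen b = subdifferential pen beta.

Definition objective n p (X : 'M[R]_(n, p)) (pen : 'cV[R]_p -> R)
    (y : 'cV[R]_n) (b : 'cV[R]_p) : R :=
  2^-1 * norm2 (y - X *m b) ^+ 2 + pen b.

Definition solutions n p (X : 'M[R]_(n, p)) (pen : 'cV[R]_p -> R)
    (y : 'cV[R]_n) : set 'cV[R]_p :=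
  [set b | forall c, objective X pen y b <= objective X pen y c].

Definition accessible n p (X : 'M[R]_(n, p)) (lambda : R)
    (pen : 'cV[R]_p -> R) (beta : 'cV[R]_p) : Prop :=
  exists (y : 'cV[R]_n) (betahat : 'cV[R]_p),
    solutions X (fun b => lambda * pen b) y betahat /\
    same_pattern pen betahat beta.

End euclidean.

Section lebesgue_tuple.
Local Open Scope ereal_scope.
Context {R : realType}.
Local Notation RR := (measurableTypeR R).

Definition cons_pair n (z : RR * n.-tuple RR) : n.+1.-tuple RR :=
  [the n.+1.-tuple RR of z.1 :: z.2].

Lemma measurable_cons_pair n : measurable_fun setT (@cons_pair n).
Proof. exact: measurable_cons. Qed.

Definition lebesgue_cons n
    (m : {sigma_finite_measure set (n.-tuple RR) -> \bar R}) :
    set (n.+1.-tuple RR) -> \bar R :=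
  pushforward (@lebesgue_measure R \x m) (@cons_pair n).

Section lebesgue_cons_measure.
Variables (n : nat) (m : {sigma_finite_measure set (n.-tuple RR) -> \bar R}).

Let mu := measure_function_pushforward__canonical__measure_function_Measure
  (@lebesgue_measure R \x m) (@measurable_cons_pair n).

Let lebesgue_cons0 : lebesgue_cons m set0 = 0.
Proof. exact: (measure0 mu). Qed.

Let lebesgue_cons_ge0 A : 0 <= lebesgue_cons m A.
Proof. exact: (measure_ge0 mu). Qed.

Let lebesgue_cons_sigma_additive : semi_sigma_additive (lebesgue_cons m).
Proof. exact: (@measure_semi_sigma_additive _ _ _ mu). Qed.

HB.instance Definition _ := isMeasure.Build _ _ _ (lebesgue_cons m)
  lebesgue_cons0 lebesgue_cons_ge0 lebesgue_cons_sigma_additive.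

End lebesgue_cons_measure.

Let uncons n (t : n.+1.-tuple RR) : RR * n.-tuple RR :=
  (thead t, [tuple of behead t]).

Let measurable_uncons n : measurable_fun setT (@uncons n).
Proof.
apply: measurable_fun_pair; first exact: measurable_tnth.
exact: measurable_behead.
Qed.

Let cons_pairK n : cancel (@cons_pair n) (@uncons n).
Proof. by case=> x t; congr pair; exact/val_inj. Qed.

Lemma sigma_finite_lebesgue_cons n m :
  sigma_finite setT (@lebesgue_cons n m).
Proof.
have /sigma_finiteP[F [FT ndF mF]] := sigma_finiteT (@lebesgue_measure R).
have /sigma_finiteP[G [GT ndG mG]] := sigma_finiteT m.
exists (fun i => @uncons n @^-1` (F i `*` G i)).
  rewrite -preimage_bigcup (_ : \bigcup_i _ = setT) ?preimage_setT//.
  apply/seteqP; split => // -[x t] _.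
  have [i _ Fix] : (\bigcup_i F i) x by rewrite -FT.
  have [j _ Gjt] : (\bigcup_i G i) t by rewrite -GT.
  exists (maxn i j) => //; split.
    by move: Fix; exact/subsetPset/ndF/leq_maxl.
  by move: Gjt; exact/subsetPset/ndG/leq_maxr.
move=> i; have [mFi Fi] := mF i; have [mGi Gi] := mG i; split.
  rewrite -[X in measurable X]setTI; apply: measurable_uncons => //.
  exact: measurableX.
rewrite /lebesgue_cons /pushforward -comp_preimage.
rewrite (_ : _ \o _ = id); last by apply/funext => z /=; rewrite cons_pairK.
by rewrite preimage_id product_measure1E// lte_mul_pinfty// ge0_fin_numE.
Qed.

HB.instance Definition _ n m := Measure_isSigmaFinite.Build _ _ _
  (@lebesgue_cons n m) (@sigma_finite_lebesgue_cons n m).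

(* Lebesgue measure on R ^ n, as an iterated product measure; the product
   formula for boxes, which characterizes it, is lebesgue_tuple_box. *)
Fixpoint lebesgue_tuple (n : nat) :
    {sigma_finite_measure set (n.-tuple RR) -> \bar R} :=
  match n with
  | 0%N => \d_[tuple]
  | n'.+1 => @lebesgue_cons n' (lebesgue_tuple n')
  end.

Lemma measurable_box n (A : 'I_n -> set RR) :
  (forall i, measurable (A i)) ->
  measurable [set t : n.-tuple RR | forall i, A i (tnth t i)].
Proof.
move=> mA; rewrite (_ : [set _ | _] =
    \bigcap_(i in [set: 'I_n]) ((@tnth n RR ^~ i) @^-1` A i)).
  apply: fin_bigcap_measurable => // i _; rewrite -[X in measurable X]setTI.
  exact: measurable_tnth.
by apply/seteqP; split => t At i; [move=> _; exact: At|exact: (At i)].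
Qed.

Lemma lebesgue_tuple_box n (A : 'I_n -> set RR) :
  (forall i, measurable (A i)) ->
  lebesgue_tuple n [set t | forall i, A i (tnth t i)] =
  \prod_(i < n) lebesgue_measure (A i).
Proof.
elim: n A => [|n IHn] A mA /=.
  by rewrite big_ord0 diracE mem_set// => -[].
rewrite big_ord_recl -IHn; last by move=> i; exact: mA.
rewrite /lebesgue_cons /pushforward -product_measure1E//.
- congr (_ _); apply/seteqP; split => -[x t] /=.
  + move=> At; split; first by have := At ord0.
    by move=> i; have := At (lift ord0 i); rewrite tnthS.
  + by move=> [Ax At] i; have [j ->|->//] := unliftP ord0 i; rewrite tnthS.
- by apply: (@measurable_box n (fun i => A (lift ord0 i))) => i.
Qed.

(* Random vectors live in n.-tuple, which carries the product sigma-algebra;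
   column vectors carry none in the library. *)
Definition col_of_tuple n (t : n.-tuple R) : 'cV[R]_n := \col_i tnth t i.

Definition positive_density d (T : measurableType d) (P : probability T R) n
    (Y : {RV P >-> n.-tuple RR}) : Prop :=
  exists f : n.-tuple RR -> R,
    [/\ measurable_fun setT f, forall t, (0 < f t)%R &
        forall A, measurable A ->
          distribution P Y A = \int[lebesgue_tuple n]_(t in A) (f t)%:E].

End lebesgue_tuple.

(* Main.v *)
Require Import Defs.
From HB Require Import structures.
From mathcomp Require Import all_boot all_order all_algebra.
From mathcomp Require Import all_classical all_reals all_analysis.
From mathcomp Require Import measurable_realfun ring lra.

(** The scaled penalty [q = lambda * pen] is the maximum of finitely many
    linear forms [w i]. The pattern of [b] is the same data as its active
    set [{i | w i . b = q b}] ([same_patternP]), and [b] solves the problem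
    with data [y] iff [X' (y - X b)] is a subgradient of [q] at [b]
    ([solutionsP]). So the event is that [y] lies in [pattern_region]: some
    [b] with the right active set has [X' (y - X b)] in the common
    subdifferential of the pattern.

    Uniqueness of the minimizer forces [X] to be injective on the span of
    every pattern that has a subgradient in the range of [X']
    ([unique_pattern_inj]): otherwise one could move from a solution inside
    its pattern, along the kernel of [X]. On such a span least squares
    problems are therefore solvable, by a linear formula
    ([pattern_normal_equations]).

    The region has interior. By accessibility some [X' z0] is a subgradient
    at a point [b0] of the pattern, possibly on the relative boundary of the
    subdifferential. Injectivity of [X] on the span of the points where
    [X' z0] touches [q] allows [z0] to be moved into the relative interior
    ([interior_subgradient]). Around [z + X b0], for the new [z], any
    perturbation of the data splits into [X d], with [d] in the span of the
    pattern, and a part orthogonal to the image of the span; the first moves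
    the solution inside its pattern, the second moves the subgradient inside
    the subdifferential ([pattern_region_box]). Both moves of subgradients
    rest on Farkas' lemma, through [contact_bound].

    The region is measurable because on it the solution is an affine
    function of the data, so that membership amounts to countably many
    affine inequalities ([pattern_region_affine], [dominated_rat]). Finally
    the region contains a cube, which has positive Lebesgue measure, and the
    integral of a positive density over it is positive. *)

Set Implicit Arguments.
Unset Strict Implicit.
Unset Printing Implicit Defensive.

Import Order.TTheory GRing.Theory Num.Theory.
Import numFieldNormedType.Exports.

Local Open Scope classical_set_scope.
Local Open Scope ring_scope.

(** * Inner products, Farkas and normal equations *)

Section dot_product.
Context {R : realType}.
Implicit Types (m n p : nat).

Lemma dotE m (u v : 'cV[R]_m) : dot u v = \sum_i u i 0 * v i 0.
Proof. by rewrite /dot mxE; apply: eq_bigr => i _; rewrite mxE. Qed.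

Lemma dotC m (u v : 'cV[R]_m) : dot u v = dot v u.
Proof. by rewrite !dotE; apply: eq_bigr => i _; rewrite mulrC. Qed.

Lemma dotDr m (u v w : 'cV[R]_m) : dot u (v + w) = dot u v + dot u w.
Proof. by rewrite /dot mulmxDr mxE. Qed.

Lemma dotDl m (u v w : 'cV[R]_m) : dot (u + v) w = dot u w + dot v w.
Proof. by rewrite /dot linearD mulmxDl mxE. Qed.

Lemma dotZr m a (u v : 'cV[R]_m) : dot u (a *: v) = a * dot u v.
Proof. by rewrite /dot -scalemxAr mxE. Qed.

Lemma dotZl m a (u v : 'cV[R]_m) : dot (a *: u) v = a * dot u v.
Proof. by rewrite dotC dotZr dotC. Qed.

Lemma dotNr m (u v : 'cV[R]_m) : dot u (- v) = - dot u v.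
Proof. by rewrite /dot mulmxN mxE. Qed.

Lemma dotNl m (u v : 'cV[R]_m) : dot (- u) v = - dot u v.
Proof. by rewrite dotC dotNr dotC. Qed.

Lemma dotBr m (u v w : 'cV[R]_m) : dot u (v - w) = dot u v - dot u w.
Proof. by rewrite dotDr dotNr. Qed.

Lemma dotBl m (u v w : 'cV[R]_m) : dot (u - v) w = dot u w - dot v w.
Proof. by rewrite dotDl dotNl. Qed.

Lemma dot0r m (u : 'cV[R]_m) : dot u 0 = 0.
Proof. by rewrite /dot mulmx0 mxE. Qed.

Lemma dot0l m (u : 'cV[R]_m) : dot 0 u = 0.
Proof. by rewrite dotC dot0r. Qed.

Lemma dot_suml m (I : finType) (A : pred I) (F : I -> 'cV[R]_m) v :
  dot (\sum_(i | A i) F i) v = \sum_(i | A i) dot (F i) v.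
Proof.
by rewrite (big_morph (fun u => dot u v) (fun u w => dotDl u w v) (dot0l v)).
Qed.

Lemma dot_trmul n p (X : 'M[R]_(n, p)) z b : dot (X^T *m z) b = dot z (X *m b).
Proof. by rewrite /dot trmx_mul trmxK mulmxA. Qed.

Lemma dot_ge0 m (u : 'cV[R]_m) : 0 <= dot u u.
Proof. by rewrite dotE; apply: sumr_ge0 => i _; rewrite -expr2 sqr_ge0. Qed.

Lemma dot_eq0 m (u : 'cV[R]_m) : dot u u = 0 -> u = 0.
Proof.
rewrite dotE => /eqP; rewrite psumr_eq0; last first.
  by move=> i _; rewrite -expr2 sqr_ge0.
move=> /allP u0; apply/matrixP => i j; rewrite ord1 mxE.
by have := u0 i; rewrite mem_index_enum mulf_eq0 orbb => /(_ isT)/eqP.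
Qed.

Lemma sqr_norm2 m (u : 'cV[R]_m) : norm2 u ^+ 2 = dot u u.
Proof.
rewrite /norm2 sqr_sqrtr ?sumr_ge0//; last by move=> i _; rewrite sqr_ge0.
by rewrite dotE; apply: eq_bigr => i _; rewrite expr2.
Qed.

(** Lets one radius control finitely many linear forms at once. *)
Lemma dot_family_bound m k (a : 'I_k -> 'cV[R]_m) :
  exists2 C : R, 0 < C & forall i d (x : 'cV[R]_m), 0 <= d ->
    (forall j, `|x j 0| <= d) -> `|dot (a i) x| <= C * d.
Proof.
exists (1 + \sum_i \sum_j `|a i j 0|).
  by rewrite ltr_pwDl// sumr_ge0// => i _; rewrite sumr_ge0.
move=> i d x d0 xd; rewrite dotE (le_trans (ler_norm_sum _ _ _))//.
apply: (@le_trans _ _ ((\sum_j `|a i j 0|) * d)).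
  rewrite mulr_suml; apply: ler_sum => j _.
  by rewrite normrM ler_wpM2l.
rewrite ler_wpM2r// (bigD1 i)//= addrCA lerDl addr_ge0// sumr_ge0// => l _.
by rewrite sumr_ge0.
Qed.

(** Bartl's induction on the number of inequalities. If the first one cannot be
    dropped, some [x0] satisfies the others and violates the conclusion; the
    induction hypothesis is applied after projecting along [x0] onto the kernel
    of the first functional, and the sign of [dot v x0] makes the remaining
    coefficient nonnegative. *)
Lemma farkas m k (a : 'I_k -> 'cV[R]_m) (v : 'cV[R]_m) :
  (forall x, (forall i, dot (a i) x <= 0) -> dot v x <= 0) ->
  exists2 c : 'I_k -> R, (forall i, 0 <= c i) & v = \sum_i c i *: a i.
Proof.
elim: k a v => [|k IHk] a v av.
  exists (fun=> 0) => //; rewrite big_ord0; apply: dot_eq0; apply/eqP.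
  by rewrite eq_le dot_ge0 av// => -[].
have [nec|] := pselect
    (forall x, (forall i, dot (a (lift ord0 i)) x <= 0) -> dot v x <= 0).
  have [c c0 ->] := IHk (fun i => a (lift ord0 i)) v nec.
  exists (fun i => oapp c 0 (unlift ord0 i)).
    by move=> i; case: unliftP => [j|] _ /=.
  rewrite big_ord_recl unlift_none/= scale0r add0r.
  by apply: eq_bigr => i _; rewrite liftK.
move=> /existsNP[x /not_implyP[ax /negP]]; rewrite -ltNge => vx.
have a0x : 0 < dot (a ord0) x.
  rewrite ltNge; apply/negP => a0x; move: vx; rewrite ltNge av// => i.
  by have [j ->|->] := unliftP ord0 i.
pose x0 := (dot (a ord0) x)^-1 *: x.
have a0x0 : dot (a ord0) x0 = 1 by rewrite dotZr mulVf// gt_eqF.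
have ax0 i : dot (a (lift ord0 i)) x0 <= 0.
  by rewrite dotZr pmulr_rle0 ?invr_gt0.
have vx0 : 0 < dot v x0 by rewrite dotZr mulr_gt0 ?invr_gt0.
pose a' i := a (lift ord0 i) - dot (a (lift ord0 i)) x0 *: a ord0.
have [|c c0 cE] := IHk a' (v - dot v x0 *: a ord0).
  move=> z az; have := av (z - dot (a ord0) z *: x0).
  rewrite dotBr dotZr dotBl dotZl mulrC; apply => i.
  rewrite dotBr dotZr; have [j ->|->] := unliftP ord0 i.
    by have := az j; rewrite /a' dotBl dotZl mulrC.
  by rewrite a0x0 mulr1 subrr.
exists (fun i => oapp c (dot v x0 - \sum_j c j * dot (a (lift ord0 j)) x0)
                  (unlift ord0 i)).
  move=> i; case: unliftP => [j|] _ //=.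
  rewrite subr_ge0 (le_trans _ (ltW vx0))// sumr_le0// => j _.
  by rewrite mulr_ge0_le0.
rewrite big_ord_recl unlift_none/=.
under [X in _ + X]eq_bigr do rewrite liftK/=.
rewrite -[LHS](subrK (dot v x0 *: a ord0)) cE.
rewrite scalerBl scaler_suml (_ : \sum_i _ = \sum_i c i *: a (lift ord0 i) -
    \sum_i (c i * dot (a (lift ord0 i)) x0) *: a ord0).
  by rewrite addrAC -addrA addrC.
by rewrite -sumrB; apply: eq_bigr => i _; rewrite scalerBr scalerA.
Qed.

(** The normal equations of least squares on the subspace
    [F = {d | forall j, dot (a j) d = 0}], on which [X] is injective. For
    a matrix [B] whose rows form a basis of [F], the Gram matrix [B X' X B'] is
    invertible and [H] is [B' (B X' X B')^-1 B]. *)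
Lemma normal_equations n p k (X : 'M[R]_(n, p)) (a : 'I_k -> 'cV[R]_p) :
  (forall d, (forall j, dot (a j) d = 0) -> X *m d = 0 -> d = 0) ->
  exists H : 'M[R]_p,
    (forall r j, dot (a j) (H *m r) = 0) /\
    (forall r d, (forall j, dot (a j) d = 0) ->
       dot (X^T *m (X *m (H *m r)) - r) d = 0).
Proof.
move=> Xinj; pose A := \matrix_(i < p, j < k) a j i 0.
have aA (d : 'cV_p) : (forall j, dot (a j) d = 0) <-> d^T *m A = 0.
  have dA j : (d^T *m A) 0 j = dot (a j) d.
    by rewrite mxE dotE; apply: eq_bigr => i _; rewrite !mxE mulrC.
  split=> [ad|/matrixP dA0 j]; last by rewrite -dA dA0 mxE.
  by apply/matrixP => i j; rewrite ord1 dA ad mxE.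
pose B := row_base (kermx A); pose G := B *m (X^T *m X) *m B^T.
have BA : B *m A = 0 by apply/sub_kermxP; rewrite eq_row_base.
have Gunit : G \in unitmx.
  rewrite -row_free_unit -kermx_eq0; apply/eqP/row_matrixP => i; rewrite row0.
  set v := row i _; have vG : v *m G = 0.
    by apply/sub_kermxP; exact: row_sub.
  have Xv : X *m (v *m B)^T = 0.
    apply: dot_eq0; rewrite /dot trmx_mul !trmxK.
    have -> : v *m B *m X^T *m (X *m (v *m B)^T) = v *m G *m v^T.
      by rewrite /G trmx_mul !mulmxA.
    by rewrite vG mul0mx mxE.
  have vB : v *m B = 0.
    apply: trmx_inj; rewrite trmx0; apply: Xinj => //; apply/aA.
    by rewrite trmxK -mulmxA BA mulmx0.
  by apply/(row_free_inj (row_base_free (kermx A))); rewrite mul0mx.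
exists (B^T *m (invmx G *m B)); split => [r|r d /aA dA].
  by apply/aA; rewrite -mulmxA trmx_mul trmxK -mulmxA BA mulmx0.
have /submxP[w dw] : (d^T <= B)%MS.
  by rewrite eq_row_base; apply/sub_kermxP.
have -> : d = B^T *m w^T by rewrite -trmx_mul -dw trmxK.
rewrite -dot_trmul trmxK mulmxBr [X in X - _](_ : _ = B *m r).
  by rewrite subrr dot0l.
by rewrite !mulmxA -(mulmxA B) -/G mulmxV// mul1mx.
Qed.

End dot_product.

(** * Maxima of finitely many linear forms *)

Section support_functions.
Context {R : realType} {p k : nat}.
Implicit Types (w : 'I_k -> 'cV[R]_p) (q : 'cV[R]_p -> R) (b d s z : 'cV[R]_p).

Definition is_max_of w q := forall b,
  (forall i, dot (w i) b <= q b) /\ exists i, dot (w i) b = q b.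

Definition active w q b : {set 'I_k} := [set i | dot (w i) b == q b]%SET.

(** When [q] is the maximum of the [w i], this is the convex hull
    of the [w i]. *)
Definition dominated q s := forall z, dot s z <= q z.

(** Directions along which the active functionals of [b] vary equally, that is
    the linear span of the points with the pattern of [b]. *)
Definition pattern_dir w q b d :=
  forall i j, i \in active w q b -> j \in active w q b ->
    dot (w i) d = dot (w j) d.

Section max_of.
Context w q (qw : is_max_of w q).

Lemma max_of_ge i b : dot (w i) b <= q b.
Proof. by have [] := qw b. Qed.

Lemma max_of_le b x : (forall i, dot (w i) b <= x) -> q b <= x.
Proof. by move=> wx; have [_ [i <-]] := qw b. Qed.

Lemma activeP b i : reflect (dot (w i) b = q b) (i \in active w q b).
Proof. by rewrite inE; exact: eqP. Qed.

Lemma active_ex b : exists i, i \in active w q b.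
Proof. by have [_ [i wi]] := qw b; exists i; apply/activeP. Qed.

Lemma activeE b i : (i \in active w q b) <->
  forall j, dot (w j) b <= dot (w i) b.
Proof.
split=> [/activeP -> j|wi]; first exact: max_of_ge.
by apply/activeP/eqP; rewrite eq_le max_of_ge max_of_le.
Qed.

Lemma max_ofZ t b : 0 <= t -> q (t *: b) = t * q b.
Proof.
move=> t0; apply/eqP; rewrite eq_le; apply/andP; split.
  by apply: max_of_le => j; rewrite dotZr ler_wpM2l// max_of_ge.
by have [i /activeP <-] := active_ex b; rewrite -dotZr max_of_ge.
Qed.

Lemma max_ofD b z : q (b + z) <= q b + q z.
Proof. by apply: max_of_le => i; rewrite dotDr lerD// max_of_ge. Qed.

Lemma max_of0 : q 0 = 0.
Proof. by rewrite -(scale0r 0) max_ofZ// mul0r. Qed.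

Lemma subdifferentialP b s :
  subdifferential q b s <-> dominated q s /\ dot s b = q b.
Proof.
split=> [sb|[sq sb] z]; last by rewrite dotBr sb addrC subrK.
have sbE : dot s b = q b.
  apply/eqP; rewrite eq_le; apply/andP; split.
    have := sb (2 *: b); rewrite dotBr dotZr max_ofZ// => sb2; lra.
  by have := sb 0; rewrite max_of0 dotBr dot0r; lra.
by split=> // z; have := sb z; rewrite dotBr sbE; lra.
Qed.

Lemma active_subdifferential b i :
  i \in active w q b <-> subdifferential q b (w i).
Proof.
rewrite subdifferentialP; split=> [/activeP wb|[_ ?]]; last exact/activeP.
by split=> // z; exact: max_of_ge.
Qed.

(** Patterns are relatively open in their span: for small [d] in the span no
    inactive functional catches up with the active ones. *)
Lemma active_stable b : exists2 e : R, 0 < e & forall d,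
  (forall i, `|dot (w i) d| <= e) -> pattern_dir w q b d ->
  active w q (b + d) = active w q b.
Proof.
(* Moving each functional by at most a third of the smallest gap preserves the
   strict inequalities. *)
pose e := \big[Num.min/1]_(i | i \notin active w q b)
  ((q b - dot (w i) b) / 3).
have e0 : 0 < e.
  apply: lt_bigmin => // i wi; rewrite divr_gt0// subr_gt0 lt_neqAle.
  by rewrite max_of_ge andbT; apply: contra wi => /eqP wi; exact/activeP.
exists e => // d de bd; have [i0 wi0] := active_ex b.
have wib i : i \notin active w q b -> 3 * e <= q b - dot (w i) b.
  move=> wi; have : e <= (q b - dot (w i) b) / 3 by exact: bigmin_le_cond.
  by rewrite ler_pdivlMr// mulrC.
have qbd : q (b + d) = q b + dot (w i0) d.
  apply/eqP; rewrite eq_le; apply/andP; split; last first.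
    by rewrite -(activeP _ _ wi0) -dotDr max_of_ge.
  apply: max_of_le => i; rewrite dotDr.
  have [wi|/wib wi] := boolP (i \in active w q b).
    by rewrite (activeP _ _ wi) (bd i i0).
  have := de i; have := de i0; rewrite !ler_norml => /andP[? ?] /andP[? ?].
  lra.
apply/setP => i; have [wi|wi] := boolP (i \in active w q b).
  by apply/activeP; rewrite qbd dotDr (activeP _ _ wi) (bd i i0).
apply/negbTE/negP => /activeP; rewrite qbd dotDr.
have := wib _ wi.
have := de i; have := de i0; rewrite !ler_norml => /andP[? ?] /andP[? ?].
lra.
Qed.

Lemma pattern_dirZ t b d : pattern_dir w q b d -> pattern_dir w q b (t *: d).
Proof. by move=> bd i j wi wj; rewrite !dotZr (bd i j). Qed.

Lemma active_stable_ray b d : pattern_dir w q b d ->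
  exists2 t : R, 0 < t & active w q (b + t *: d) = active w q b.
Proof.
move=> bd; have [e e0 eP] := active_stable b.
pose m := \sum_i `|dot (w i) d|.
have m0 : 0 <= m by exact: sumr_ge0.
exists (e / (1 + m)); first by rewrite divr_gt0// ltr_pwDl.
apply: eP; last exact: pattern_dirZ.
move=> i; rewrite dotZr normrM gtr0_norm ?divr_gt0 ?ltr_pwDl//.
rewrite mulrAC ler_pdivrMr ?ltr_pwDl// ler_wpM2l ?(ltW e0)//.
rewrite (@le_trans _ _ m)// ?lerDr// /m (bigD1 i)//= lerDl.
exact: sumr_ge0.
Qed.

(** [<-]: the segment from [b'] to [b] extends slightly beyond [b] with the same
    active set. For a subgradient [s] at [b], the function [q z - dot s z] is
    affine and nonnegative on this longer segment and vanishes at its interior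
    point [b], hence also at [b']. *)
Lemma same_patternP b b' : same_pattern q b b' <-> active w q b = active w q b'.
Proof.
rewrite /same_pattern; split=> [bb'|].
  by apply/setP => i; apply/idP/idP => /active_subdifferential wi;
    apply/active_subdifferential; [rewrite -bb'|rewrite bb'].
suff sub c c' : active w q c = active w q c' ->
    subdifferential q c `<=` subdifferential q c'.
  by move=> bb'; apply/seteqP; split; apply: sub.
move=> cc' s /subdifferentialP[sq sc]; apply/subdifferentialP; split => //.
have dir : pattern_dir w q c (c - c').
  move=> i j wi wj; rewrite !dotBr (activeP _ _ wi) (activeP _ _ wj).
  by move: wi wj; rewrite cc' => /activeP -> /activeP ->.
have [t t0 ct] := active_stable_ray dir.
have [i wi] := active_ex c.
have wi' : i \in active w q c' by rewrite -cc'.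
have := sq (c + t *: (c - c')); rewrite -ct in wi.
rewrite -(activeP _ _ wi) !dotDr !dotZr !dotBr; rewrite ct in wi.
rewrite (activeP _ _ wi) (activeP _ _ wi') sc => le1.
apply/eqP; rewrite eq_le sq/= -subr_ge0 -(pmulr_rge0 _ t0); lra.
Qed.

(** A subgradient at [b] is one at a nearby point [b + t *: d] of the same
    pattern, hence matches [q], and so the active functionals, at both. *)
Lemma subdifferential_dir b s i d : subdifferential q b s ->
  i \in active w q b -> pattern_dir w q b d -> dot s d = dot (w i) d.
Proof.
move=> sb wi bd; have [t t0 bt] := active_stable_ray bd.
have [_ sb1] := (subdifferentialP _ _).1 sb.
have : subdifferential q (b + t *: d) s by move/same_patternP : bt => ->.
move=> /subdifferentialP[_]; move: (wi); rewrite -bt => /activeP <-.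
rewrite !dotDr !dotZr sb1 (activeP _ _ wi) => /addrI.
by apply: mulfI; rewrite gt_eqF.
Qed.

Lemma contact_pattern_dir b c : {subset active w q b <= active w q c} ->
  pattern_dir w q b c.
Proof. by move=> bc i j /bc/activeP -> /bc/activeP ->. Qed.

(** Perturbations vanishing on the contact cone of [s] stay dominated up to
    scaling: the contact cone is cut out by the functionals [w i - s], so this
    is Farkas. *)
Lemma contact_bound s v : dominated q s ->
  (forall b, dot s b = q b -> dot v b = 0) ->
  exists2 M : R, 0 <= M & forall b, dot v b <= M * (q b - dot s b).
Proof.
move=> sq vs; have [|c c0 ->] := @farkas R p k (fun i => w i - s) v.
  move=> x wx; rewrite vs//; apply/eqP; rewrite eq_le sq max_of_le// => i.
  by rewrite -subr_le0 -dotBl.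
exists (\sum_i c i); first exact: sumr_ge0.
move=> b; rewrite dot_suml mulr_suml; apply: ler_sum => i _.
by rewrite dotZl dotBl ler_wpM2l// lerB// max_of_ge.
Qed.

(** Contact cones are closed under addition and sums have the intersection of
    the active sets, so a smallest active set is contained in all others. *)
Lemma contact_generic s b0 : dominated q s -> dot s b0 = q b0 ->
  exists2 b, dot s b = q b &
    forall c, dot s c = q c -> {subset active w q b <= active w q c}.
Proof.
move=> sq sb0.
pose Q := [pred A : {set 'I_k} |
  `[< exists2 b, dot s b = q b & A = active w q b >]].
have Q0 : Q (active w q b0) by apply/asboolP; exists b0.
case: (arg_minnP (fun A : {set 'I_k} => #|A|) Q0) => A /asboolP[b sb ->] Amin.
exists b => // c sc.
have sbc : dot s (b + c) = q (b + c).
  apply/eqP; rewrite eq_le sq/= dotDr sb sc; exact: max_ofD.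
have bcE i : i \in active w q (b + c) ->
    i \in active w q b /\ i \in active w q c.
  move=> /activeP; rewrite -sbc !dotDr sb sc => wbc.
  by have := max_of_ge i b; have := max_of_ge i c;
    split; apply/activeP/eqP; rewrite eq_le max_of_ge/=; lra.
have : active w q (b + c) = active w q b.
  apply/eqP; rewrite eqEcard Amin; last by apply/asboolP; exists (b + c).
  by rewrite andbT; apply/fintype.subsetP => i /bcE[].
by move=> <- i /bcE[].
Qed.

End max_of.
End support_functions.

(** * Penalized least squares *)

Section least_squares.
Context {R : realType} {n p k : nat} (X : 'M[R]_(n, p)).
Context (w : 'I_k -> 'cV[R]_p) (q : 'cV[R]_p -> R) (qw : is_max_of w q).

Lemma objectiveD y b d : objective X q y (b + d) - objective X q y b =
  2^-1 * dot (X *m d) (X *m d) - dot (X^T *m (y - X *m b)) d +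
  (q (b + d) - q b).
Proof.
rewrite /objective !sqr_norm2 dot_trmul mulmxDr opprD addrA.
move: (y - X *m b) (X *m d) => r e.
rewrite dotBl !dotBr (dotC e r); lra.
Qed.

(** Fermat's rule. *)
Lemma solutionsP y b : solutions X q y b <->
  subdifferential q b (X^T *m (y - X *m b)).
Proof.
split=> [yb z|sb c]; last first.
  rewrite -subr_ge0 -(subrK b c) (addrC _ b) objectiveD.
  have := sb c; have := dot_ge0 (X *m (c - b)); rewrite (addrC b) subrK; lra.
rewrite -subr_ge0 leNgt; apply/negP; set s := X^T *m _ => lt0.
(* A step [t] towards [z] gains [t * g] and costs at most [t ^ 2 * N / 2]; the
   chosen [t] makes the gain larger. *)
pose e := X *m (z - b); pose N := dot e e.
pose t := (q b + dot s (z - b) - q z) / (N + (q b + dot s (z - b) - q z)).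
have N0 : 0 <= N by exact: dot_ge0.
set g := q b + dot s (z - b) - q z in t.
have g0 : 0 < g by rewrite /g; lra.
have t0 : 0 < t by rewrite divr_gt0// ltr_wpDl.
have tE : t * (N + g) = g by rewrite divfK// gt_eqF// ltr_wpDl.
have t1 : t <= 1 by rewrite ler_pdivrMr ?mul1r ?lerDr// ltr_wpDl.
have := yb (b + t *: (z - b)).
rewrite -subr_ge0 objectiveD -/s -scalemxAr dotZl !dotZr -/e -/N.
have : q (b + t *: (z - b)) <= (1 - t) * q b + t * q z.
  rewrite -!(max_ofZ qw) ?subr_ge0 ?(ltW t0)//.
  rewrite (_ : _ + _ = (1 - t) *: b + t *: z); first exact: (max_ofD qw).
  by rewrite scalerBr scalerBl scale1r addrA addrAC.
suff : 0 < t * (g - t * N / 2) by rewrite /g; lra.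
rewrite mulr_gt0//.
by have := mulr_gt0 t0 g0; have := mulr_ge0 (ltW t0) N0; lra.
Qed.

(** Moving from a solution along a direction of its pattern that [X] does not
    see yields further solutions for the same data. *)
Lemma unique_pattern_inj z b d :
  (forall y b1 b2, solutions X q y b1 -> solutions X q y b2 -> b1 = b2) ->
  subdifferential q b (X^T *m z) -> pattern_dir w q b d -> X *m d = 0 -> d = 0.
Proof.
move=> Xq sb bd Xd; have [t t0 bt] := active_stable_ray qw bd.
have bs : solutions X q (z + X *m b) b.
  by apply/solutionsP; rewrite addrK.
have bts : solutions X q (z + X *m b) (b + t *: d).
  apply/solutionsP; rewrite (mulmxDr X) -scalemxAr Xd scaler0 addr0 addrK.
  by move/(same_patternP qw) : bt => ->.
have /eqP := Xq _ _ _ bs bts; rewrite -subr_eq0 opprD addrA subrr sub0r.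
by rewrite oppr_eq0 scaler_eq0 (gt_eqF t0) => /eqP.
Qed.

Context (Xq_unique :
  forall y b1 b2, solutions X q y b1 -> solutions X q y b2 -> b1 = b2).

Lemma pattern_normal_equations z b : subdifferential q b (X^T *m z) ->
  exists H : 'M[R]_p,
    (forall r, pattern_dir w q b (H *m r)) /\
    (forall r d, pattern_dir w q b d ->
       dot (X^T *m (X *m (H *m r)) - r) d = 0).
Proof.
move=> sb; have [i0 wi0] := active_ex qw b.
pose a j := if j \in active w q b then w j - w i0 else 0.
have aP d : (forall j, dot (a j) d = 0) <-> pattern_dir w q b d.
  split=> [ad i j wi wj|bd j].
    have := ad i; have := ad j; rewrite /a wi wj !dotBl; lra.
  by rewrite /a; case: ifPn => wj; rewrite ?dot0l// dotBl (bd j i0)// subrr.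
have [|H [Ha HX]] := @normal_equations R n p k X a.
  by move=> d /aP bd; exact: (unique_pattern_inj Xq_unique sb).
by exists H; split=> [r|r d bd]; [apply/aP|apply/HX/aP].
Qed.

(** An accessible pattern has a subgradient [X^T *m z] in the relative interior
    of its subdifferential. Starting from [z0], [X] is injective on the
    span of the contact cone of [X^T *m z0], so some [x] acts on that
    cone like [\sum_i (w i - X^T *m z0)], the sum over the active [i]; moving
    [z0] slightly along [x] is possible by [contact_bound] and leaves in contact
    only points where all these [w i] are active. *)
Lemma interior_subgradient z0 b0 : subdifferential q b0 (X^T *m z0) ->
  exists2 z, subdifferential q b0 (X^T *m z) &
    forall b, dot (X^T *m z) b = q b ->
      {subset active w q b0 <= active w q b}.
Proof.
move=> z0b0; have [sq sb0] := (subdifferentialP qw _ _).1 z0b0.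
set s0 := X^T *m z0 in z0b0 sq sb0 *.
have [b1 sb1 b1min] := contact_generic qw sq sb0.
have sub1 : subdifferential q b1 s0 by apply/subdifferentialP.
have [H [_ HX]] := pattern_normal_equations sub1.
pose A := active w q b0.
pose r := \sum_(i in A) (w i - s0).
pose x := X *m (H *m r).
have vs b : dot s0 b = q b -> dot (X^T *m x - r) b = 0.
  by move=> sb; apply/HX/contact_pattern_dir/b1min.
have [M M0 vM] := contact_bound qw sq vs.
(* With this step the gap [q b - dot (X^T *m z) b] becomes [e] times a sum of
   three nonnegative terms, as [zE] shows. *)
pose e := (M + #|A|%:R + 1)^-1.
have e0 : 0 < e by rewrite invr_gt0 ltr_wpDl// addr_ge0.
pose z := z0 + e *: x.
have rE b : dot r b = \sum_(i in A) (dot (w i) b - q b) +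
    #|A|%:R * (q b - dot s0 b).
  rewrite dot_suml mulr_natl -sumr_const -big_split/=.
  by apply: eq_bigr => i _; rewrite dotBl; lra.
have zE b : q b - dot (X^T *m z) b =
    e * ((M * (q b - dot s0 b) - dot (X^T *m x - r) b) + (q b - dot s0 b) +
         \sum_(i in A) (q b - dot (w i) b)).
  have eE : e * (M + #|A|%:R + 1) = 1.
    by rewrite mulVf// gt_eqF// ltr_wpDl// addr_ge0.
  rewrite mulmxDr -/s0 -scalemxAr dotDl dotZl dotBl rE.
  under [in RHS]eq_bigr do rewrite -opprB.
  rewrite sumrN; set S := \sum_(i in A) _.
  transitivity (e * (M + #|A|%:R + 1) * (q b - dot s0 b) -
      e * dot (X^T *m x) b); first by rewrite eE; ring.
  ring.
have A0 b : 0 <= \sum_(i in A) (q b - dot (w i) b).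
  by apply: sumr_ge0 => i _; rewrite subr_ge0 max_of_ge.
have zq : dominated q (X^T *m z).
  move=> b; rewrite -subr_ge0 zE mulr_ge0 ?(ltW e0)// addr_ge0// addr_ge0//.
    by rewrite subr_ge0.
  by rewrite subr_ge0.
exists z => [|b zb].
  apply/subdifferentialP => //; split => //; apply/eqP.
  rewrite eq_sym -subr_eq0 zE vs// sb0 subrr mulr0 subr0 add0r.
  rewrite big1 ?addr0 ?mulr0// => i /activeP ->; exact: subrr.
move=> i Ai; apply/activeP/eqP; rewrite eq_sym -subr_eq0 eq_le.
rewrite andbC subr_ge0 max_of_ge//=.
have := zE b; rewrite zb subrr => /esym/eqP; rewrite mulf_eq0 gt_eqF//=.
have : \sum_(j in A) (q b - dot (w j) b) = (q b - dot (w i) b) +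
    \sum_(j in A | j != i) (q b - dot (w j) b) by rewrite (bigD1 i).
have : 0 <= \sum_(j in A | j != i) (q b - dot (w j) b).
  by apply: sumr_ge0 => j _; rewrite subr_ge0 max_of_ge.
by have := vM b; have := sq b => ? ? ? -> /eqP; lra.
Qed.

End least_squares.

(** * The set of data with a given pattern *)

Section pattern_region.
Context {R : realType} {n p k : nat} (X : 'M[R]_(n, p)).
Context (w : 'I_k -> 'cV[R]_p) (q : 'cV[R]_p -> R) (qw : is_max_of w q).
Context (Xq_unique :
  forall y b1 b2, solutions X q y b1 -> solutions X q y b2 -> b1 = b2).
Context (z0 : 'cV[R]_n) (b0 : 'cV[R]_p).
Context (z0b0 : subdifferential q b0 (X^T *m z0)).

Definition pattern_region : set 'cV[R]_n :=
  [set y | exists2 b, active w q b = active w q b0 & solutions X q y b].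

(** Around [z + X *m b0], with [z] from [interior_subgradient], a perturbation
    of the data splits into a part [X *m d] with [d] in the pattern span, which
    moves the solution to [b0 + d], and a part orthogonal to it, which moves
    the subgradient within the subdifferential. *)
Lemma pattern_region_box : exists (y0 : 'cV[R]_n) (e : R), 0 < e /\
  forall y : 'cV[R]_n, (forall j, `|y j 0 - y0 j 0| <= e) -> pattern_region y.
Proof.
have [z zb0 zmin] := interior_subgradient qw Xq_unique z0b0.
set s := X^T *m z in zb0 zmin *.
have [H [Hdir HX]] := pattern_normal_equations qw Xq_unique zb0.
have [sq sb0] := (subdifferentialP qw _ _).1 zb0.
have [eps eps0 epsP] := active_stable qw b0.
(* [L *m h] is [X^T] applied to the part of [h] orthogonal to the image of the
   pattern span under [X]. *)
pose L : 'M[R]_(p, n) := X^T - X^T *m X *m H *m X^T.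
have Lperp h c : dot s c = q c -> dot (L *m h) c = 0.
  move=> sc; have := HX (X^T *m h) c (contact_pattern_dir (zmin _ sc)).
  rewrite /L mulmxBl -!mulmxA dotBl => Lc; rewrite dotBl; lra.
have colL j : L *m delta_mx j 0 = col j L by rewrite -colE.
have /fin_all_exists2[M M0 LM] j : exists2 M : R, 0 <= M &
    forall c, dot (col j L) c <= M * (q c - dot s c).
  by apply: contact_bound => // c sc; rewrite -colL Lperp.
have /fin_all_exists2[N N0 LN] j : exists2 N : R, 0 <= N &
    forall c, dot (- col j L) c <= N * (q c - dot s c).
  by apply: contact_bound => // c sc; rewrite -colL dotNl Lperp ?oppr0.
have [C C0 HC] := dot_family_bound (fun i => (H *m X^T)^T *m w i).
pose S := \sum_j (M j + N j).
have S0 : 0 <= S by apply: sumr_ge0 => j _; exact: addr_ge0.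
(* The first bound keeps the subgradient dominated, the second keeps [b0 + d] in
   the pattern. *)
pose e := Num.min (1 + S)^-1 (eps / C).
have e0 : 0 < e by rewrite lt_min invr_gt0 divr_gt0// ltr_pwDl.
exists (z + X *m b0), e; split=> // y ye.
pose h := y - (z + X *m b0); pose d := H *m X^T *m h.
have he j : `|h j 0| <= e.
  by rewrite (_ : h j 0 = y j 0 - (z + X *m b0) j 0) ?ye// !mxE.
have bd : active w q (b0 + d) = active w q b0.
  apply: epsP; last by rewrite /d -mulmxA.
  move=> i; rewrite /d -[H *m X^T]trmxK dotC dot_trmul dotC.
  rewrite (le_trans (HC i _ _ (ltW e0) he))//.
  by rewrite mulrC -ler_pdivlMr// ge_min lexx orbT.
exists (b0 + d) => //; apply/(solutionsP _ qw).
have -> : X^T *m (y - X *m (b0 + d)) = s + L *m h.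
  rewrite /L mulmxBl /s -!mulmxA -mulmxBr -mulmxDr; congr (_ *m _).
  rewrite (mulmxDr X) /d /h -mulmxA; move: (X *m (H *m _)) => D.
  by rewrite !opprD !addrA [z + y]addrC addrK.
move/(same_patternP qw) : bd => ->; apply/(subdifferentialP qw).
split=> [c|]; last by rewrite dotDl Lperp// addr0.
have [qsc Lhc] : 0 <= q c - dot s c /\
    dot (L *m h) c = \sum_j h j 0 * dot (col j L) c.
  split; first by rewrite subr_ge0.
  rewrite -[in LHS](trmxK L) dot_trmul dotE; apply: eq_bigr => j _.
  rewrite [X in _ * X = _]mxE dotE; congr (_ * _).
  by apply: eq_bigr => i _; rewrite mxE [in RHS]mxE.
rewrite dotDl addrC -lerBrDr Lhc.
rewrite (@le_trans _ _ (\sum_j e * (M j + N j) * (q c - dot s c)))//.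
  apply: ler_sum => j _; rewrite (le_trans (ler_norm _))// normrM.
  rewrite -mulrA ler_pM// ler_norml mulrDl.
  have := LM j c; have := LN j c; rewrite dotNl.
  have := mulr_ge0 (M0 j) qsc; have := mulr_ge0 (N0 j) qsc => *.
  by apply/andP; split; lra.
rewrite -mulr_suml -mulr_sumr -/S -[leRHS]mul1r ler_wpM2r//.
rewrite (@le_trans _ _ ((1 + S)^-1 * S)) ?ler_wpM2r ?ge_min ?lexx//.
by rewrite ler_pdivrMl ?mulr1 ?lerDr// ltr_pwDl.
Qed.

(** On the region the solution is an affine function of the data, given by
    the normal equations, which turns the existential into explicit affine
    conditions. *)
Lemma pattern_region_affine : exists (B : 'M[R]_(p, n)) (b1 : 'cV[R]_p),
  forall y, pattern_region y <->
    active w q (B *m y + b1) = active w q b0 /\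
    dominated q (X^T *m (y - X *m (B *m y + b1))).
Proof.
have [H [Hdir HX]] := pattern_normal_equations qw Xq_unique z0b0.
have [i0 wi0] := active_ex qw b0.
exists (H *m X^T), (- (H *m w i0)) => y.
have -> : H *m X^T *m y - H *m w i0 = H *m (X^T *m y - w i0).
  by rewrite mulmxBr mulmxA.
set r := X^T *m y - w i0; set b1 := H *m r.
have rX b : X^T *m (y - X *m b) = r - X^T *m (X *m b) + w i0.
  by rewrite mulmxBr /r addrAC subrK.
split=> [[b bb0 /(solutionsP _ qw) yb]|[b1b0 sb1]].
  suff -> : b1 = b by split=> //; have [] := (subdifferentialP qw _ _).1 yb.
  have dir d : pattern_dir w q b0 d -> dot (r - X^T *m (X *m b)) d = 0.
    move=> dd; have wib : i0 \in active w q b by rewrite bb0.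
    have := subdifferential_dir qw yb wib.
    rewrite /pattern_dir bb0 => /(_ d dd).
    rewrite rX dotDl; lra.
  have bdir : pattern_dir w q b0 b by apply: contact_pattern_dir; rewrite bb0.
  have ddir : pattern_dir w q b0 (b1 - b).
    by move=> i j wi wj; rewrite !dotBr (Hdir _ i j)// (bdir i j).
  apply/eqP; rewrite -subr_eq0; apply/eqP.
  apply: (unique_pattern_inj qw Xq_unique z0b0 ddir); apply: dot_eq0.
  rewrite -dot_trmul !mulmxBr.
  have := HX r _ ddir; have := dir _ ddir; rewrite -/b1 !dotBl; lra.
exists b1 => //; apply/(solutionsP _ qw)/(subdifferentialP qw); split=> //.
have wi1 : i0 \in active w q b1 by rewrite b1b0.
rewrite rX dotDl (activeP _ _ _ _ wi1) -[X in X + _]opprK -dotNl opprB.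
by rewrite HX ?oppr0 ?add0r//; exact: Hdir.
Qed.

End pattern_region.

(** * Measurability of the region *)

Section rational_points.
Context {R : realType}.

(** Rational points suffice since [q] is a maximum of finitely many linear
    forms, so a violation persists nearby. *)
Lemma dominated_rat p k (w : 'I_k -> 'cV[R]_p) q s : is_max_of w q ->
  (forall c : 'cV[rat]_p, dot s (map_mx ratr c) <= q (map_mx ratr c)) ->
  dominated q s.
Proof.
move=> qw sq c; rewrite leNgt; apply/negP => sc.
have [C C0 CP] := dot_family_bound (fun i => w i - s).
(* Moving [c] by at most [d] changes each [dot (w i - s) c] by at most half of
   the violation. *)
pose d := (dot s c - q c) / (2 * C).
have d0 : 0 < d by rewrite divr_gt0 ?subr_gt0// mulr_gt0.
have /fin_all_exists[f fP] j : exists a : rat, `|ratr a - c j 0| <= d.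
  have [|a] := @rat_in_itvoo R (c j 0 - d) (c j 0 + d); first lra.
  rewrite in_itv/= => /andP[? ?]; exists a.
  by rewrite ler_norml; apply/andP; split; lra.
have := sq (\col_j f j); rewrite leNgt => /negP; apply.
set c' := map_mx _ _; have [i /activeP <-] := active_ex qw c'.
have := CP i d (c' - c) (ltW d0).
rewrite !dotBl !dotBr ler_norml (_ : C * d = (dot s c - q c) / 2); last first.
  by rewrite /d; field; rewrite gt_eqF.
have := max_of_ge qw i c => wic /(_ _)/andP[|_].
  by move=> j; rewrite !mxE fP.
lra.
Qed.

End rational_points.

Section measurable_region.
Context {R : realType} {d : measure_display} {T : measurableType d} {n : nat}.
Context (Y : T -> n.-tuple (measurableTypeR R)) (mY : measurable_fun setT Y).

Lemma measurable_halfspace (v : 'cV[R]_n) (c : R) :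
  measurable [set t | dot v (col_of_tuple (Y t)) <= c].
Proof.
rewrite -[X in measurable X]setTI; apply: measurable_fun_le => //.
rewrite (_ : (fun t => _) = fun t => \sum_j v j 0 * tnth (Y t) j).
  apply: measurable_sum => j; apply: measurable_funM => //.
  exact: (measurableT_comp (measurable_tnth j) mY).
by apply/funext => t; rewrite dotE; apply: eq_bigr => j _; rewrite mxE.
Qed.

Lemma measurable_pattern_region p k (X : 'M[R]_(n, p)) (w : 'I_k -> 'cV[R]_p) q
    (z0 : 'cV[R]_n) b0 :
  is_max_of w q ->
  (forall y b1 b2, solutions X q y b1 -> solutions X q y b2 -> b1 = b2) ->
  subdifferential q b0 (X^T *m z0) ->
  measurable [set t | pattern_region X w q b0 (col_of_tuple (Y t))].
Proof.
move=> qw Xq z0b0; have [B [b1 regE]] := pattern_region_affine qw Xq z0b0.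
pose b t := B *m col_of_tuple (Y t) + b1.
pose S i j := [set t | dot (w j) (b t) <= dot (w i) (b t)].
have mS i j : measurable (S i j).
  rewrite (_ : S i j = [set t |
      dot (B^T *m (w j - w i)) (col_of_tuple (Y t)) <= dot (w i - w j) b1]).
    exact: measurable_halfspace.
  apply/funext => t; rewrite /S/= /b dot_trmul !dotBl !dotDr.
  by apply/propext; split => ?; lra.
pose A i := if i \in active w q b0 then \bigcap_j S i j else ~` \bigcap_j S i j.
have mA i : measurable (A i).
  have mSi : measurable (\bigcap_j S i j) by exact: fin_bigcap_measurable.
  by rewrite /A; case: ifP => // _; exact: measurableC.
pose s t := X^T *m (col_of_tuple (Y t) - X *m b t).
pose D (c : 'cV[rat]_p) :=
  [set t | dot (s t) (map_mx ratr c) <= q (map_mx ratr c)].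
have mD c : measurable (D c).
  pose x : 'cV[R]_n := X *m map_mx ratr c.
  rewrite (_ : D c = [set t |
      dot (x - (X *m B)^T *m x) (col_of_tuple (Y t)) <=
      q (map_mx ratr c) + dot (X *m b1) x]).
    exact: measurable_halfspace.
  apply/funext => t; rewrite /D/= /s dot_trmul -/x /b mulmxDr !dotBl dotDl.
  rewrite dot_trmul mulmxA !(dotC x).
  by apply/propext; split => ?; lra.
(* Rational vectors are enumerated by [unpickle]; unused codes impose no
   condition. *)
pose D' m := if unpickle m is Some c then D c else setT.
rewrite (_ : [set _ | _] = (\bigcap_i A i) `&` (\bigcap_m D' m)).
  apply: measurableI; first exact: fin_bigcap_measurable.
  by apply: bigcapT_measurable => m; rewrite /D'; case: unpickle.
apply/seteqP; split=> t /=.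
  move=> /regE[bb0 sq]; split=> [i _|m _]; last first.
    by rewrite /D'; case: unpickle => // c; exact: sq.
  rewrite /A -bb0; case: ifPn => [/(activeE qw) bi j _|/negP bi cap].
    exact: bi.
  by apply: bi; apply/(activeE qw) => j; exact: cap.
move=> [At Dt]; apply/regE; split; last first.
  apply: (dominated_rat qw) => c; have := Dt (pickle c) I.
  by rewrite /D' pickleK.
apply/setP => i; have := At i I; rewrite /A.
case: ifPn => [_ cap|_ cap].
  by apply/(activeE qw) => j; exact: cap.
by apply/negP => /(activeE qw) bi; apply: cap => j _; exact: bi.
Qed.

End measurable_region.

(** * Positive probability *)

Section positivity.
Context {R : realType}.

Lemma integral_gt0 d (T : measurableType d) (mu : {measure set T -> \bar R})
    (A : set T) (f : T -> R) : measurable A -> measurable_fun setT f ->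
  (forall t, 0 < f t) -> (0 < mu A -> 0 < \int[mu]_(t in A) (f t)%:E)%E.
Proof.
move=> mA mf f0 muA; rewrite lt_neqAle integral_ge0 ?andbT; last first.
  by move=> t _; rewrite lee_fin ltW.
apply/negP => /eqP int0.
have mfE : measurable_fun A (EFin \o f).
  by apply/measurable_EFinP; exact: measurable_funTS.
have : ae_eq mu A (EFin \o f) (cst 0%E).
  apply/ae_eq_integral_abs => //; rewrite [RHS]int0; apply: eq_integral => t _.
  by rewrite /= gtr0_norm.
move=> [N [mN N0 AN]]; move: muA; rewrite ltNge -N0 le_measure ?inE// => t At.
by apply: AN => /= /(_ At)[] /eqP; rewrite gt_eqF.
Qed.

Definition cube n (c : 'I_n -> R) (e : R) :
    set (n.-tuple (measurableTypeR R)) :=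
  [set t | forall i, [set` `[c i - e, c i + e]] (tnth t i : R)].

Lemma lebesgue_tuple_cube_gt0 n (c : 'I_n -> R) (e : R) : 0 < e ->
  measurable (cube c e) /\ (0 < lebesgue_tuple n (cube c e))%E.
Proof.
move=> e0; pose J i := [set` `[c i - e, c i + e]] : set (measurableTypeR R).
have mJ i : measurable (J i) by exact: measurable_itv.
split; first exact: (measurable_box mJ).
rewrite (_ : cube c e = [set t | forall i, J i (tnth t i)])//.
rewrite lebesgue_tuple_box//.
elim/big_ind: _ => //; first exact: mule_gt0.
move=> i _; rewrite lebesgue_measure_itv/= lte_fin ifT -?EFinB ?lte_fin; lra.
Qed.

End positivity.

Theorem corollary4p4 (R : realType) (n p : nat) (X : 'M[R]_(n, p)) (lambda : R)
    (lambda_gt0 : 0 < lambda)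
    (pen : 'cV[R]_p -> R) (pen_gauge : polyhedral_gauge pen)
    (beta : 'cV[R]_p) (beta_accessible : accessible X lambda pen beta)
    (betahat : 'cV[R]_n -> 'cV[R]_p)
    (uniform_uniqueness : forall y : 'cV[R]_n,
       solutions X (fun b => lambda * pen b) y = [set betahat y])
    (d : measure_display) (Omega : measurableType d) (P : probability Omega R)
    (Y : {RV P >-> n.-tuple (measurableTypeR R)})
    (Y_density : positive_density Y) :
  let E := [set w : Omega |
              same_pattern pen (betahat (col_of_tuple (Y w))) beta] in
  measurable E /\ (0 < P E)%E.
Proof.
move=> E; have [k [u [_ penE]]] := pen_gauge.
have penu : is_max_of u pen.
  move=> b; rewrite penE; split=> [i|].
    exact: (le_bigmax _ (fun i => dot (u i) b)).
  apply: (big_ind (fun x => exists i, dot (u i) b = x)) => [|x y xi yi|i _].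
  - by exists ord0.
  - by case: (leP x y).
  - by exists i.
pose q b := lambda * pen b; pose w i := lambda *: u i.
have qw : is_max_of w q.
  move=> b; have [pu [i ui]] := penu b; split=> [j|]; last first.
    by exists i; rewrite dotZl ui.
  by rewrite /q dotZl ler_wpM2l ?(ltW lambda_gt0)// pu.
have patE b b' : same_pattern pen b b' <-> active w q b = active w q b'.
  suff actE c : active u pen c = active w q c.
    by rewrite (same_patternP penu) !actE.
  apply/setP => i; rewrite !inE /q dotZl.
  by rewrite (inj_eq (mulfI (lt0r_neq0 lambda_gt0))).
have Xq y b1 b2 : solutions X q y b1 -> solutions X q y b2 -> b1 = b2.
  by rewrite uniform_uniqueness => -> ->.
have [y0 [b0 [/(solutionsP X qw) z0b0 /patE b0beta]]] := beta_accessible.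
have regE y : same_pattern pen (betahat y) beta <-> pattern_region X w q b0 y.
  rewrite patE -b0beta; split=> [yb|[b bb0]].
    by exists (betahat y) => //; rewrite uniform_uniqueness.
  by rewrite uniform_uniqueness => <-.
have mY : measurable_fun setT Y by exact: measurable_funP.
have mE : measurable E.
  rewrite (_ : E = [set t | pattern_region X w q b0 (col_of_tuple (Y t))]).
    exact: (measurable_pattern_region mY qw Xq z0b0).
  by apply/funext => t; apply/propext; exact: regE.
split=> //; have [c [e [e0 box]]] := pattern_region_box qw Xq z0b0.
pose Q := cube (fun i => c i 0) e.
have [mQ Q0] := lebesgue_tuple_cube_gt0 (fun i => c i 0) e0.
have [f [mf f0 fE]] := Y_density.
have : (0 < distribution P Y Q)%E by rewrite fE//; exact: integral_gt0.
move=> /lt_le_trans; apply.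
rewrite /distribution /pushforward le_measure ?inE//.
  by rewrite -[X in measurable X]setTI; exact: mY.
move=> t Qt; apply/regE/box => j.
by have := Qt j; rewrite /= in_itv/= mxE -ler_distlC distrC.
Qed.
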